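(* Let $t>0$ and, for $n\ge 2$, $$h_n(x;t)=\sum_{d=1}^{n-1}\sum_{i=1}^{d}\binom{n-i-1}{d-i}\binom{n-d-1}{i-1}\,t^i x^d .$$ Then $\{h_n(x;t)\}_{n\ge 2}$ (as polynomials in $x$) is a generalized Sturm sequence, i.e. each $h_n(x;t)$ lies in $\mathrm{PF}$ and $$h_2(x;t)\preceq h_3(x;t)\preceq h_4(x;t)\preceq\cdots.$$
   Context: Binomial coefficients $\binom{m}{k}$ are $0$ when $k>m$ or $k<0$. $\mathrm{PF}$ denotes the set of real-rooted polynomials with nonnegative coefficients (including nonnegative constants). For $f,g\in\mathrm{PF}$ with zeros $u_1\ge u_2\ge\cdots$ of $f$ and $v_1\ge v_2\ge\cdots$ of $g$, write $g\preceq f$ (''$g$ interlaces $f$'') if either $\deg f=\deg g=m$ and $v_m\le u_m\le\cdots\le v_2\le u_2\le v_1\le u_1$, or $\deg f=\deg g+1=m$ and $u_m\le v_{m-1}\le u_{m-1}\le\cdots\le v_1\le u_1$; by convention also $a\preceq bx+c$ for nonnegative $a,b,c$, and $0\preceq f$, $f\preceq 0$ for every $f\in\mathrm{PF}$. *)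

(* Defs.v *)
From mathcomp Require Import all_boot all_order all_algebra.
From mathcomp Require Import reals.

Set Implicit Arguments.
Unset Strict Implicit.
Unset Printing Implicit Defensive.

Import Order.TTheory GRing.Theory Num.Theory.
Local Open Scope ring_scope.

Section Definitions.
Variable R : realType.
Implicit Types (f g : {poly R}) (s u v : seq R).

(* [s] lists the zeros of [f] with multiplicity, so for [f != 0] its size is
   the degree of [f]; every [s] qualifies for [f = 0]. *)
Definition zeros_of f s : Prop :=
  f = lead_coef f *: \prod_(z <- s) ('X - z%:P).

(* All zeros are real, i.e. [f] splits over [R]; constants, including 0,
   are real-rooted. *)
Definition real_rooted f : Prop := exists s, zeros_of f s.

Definition PF f : Prop := real_rooted f /\ (forall k, 0 <= f`_k).

(* With [u_(i+1) = u`_i] and [v_(i+1) = v`_i], these inequalities are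
   [v_m <= u_m <= ... <= v_1 <= u_1] when [size u = size v = m], and
   [u_m <= v_(m-1) <= ... <= v_1 <= u_1] when [size u = (size v).+1 = m]. *)
Definition alternates v u : Prop :=
  (forall i, (i < size v)%N -> v`_i <= u`_i) /\
  (forall i, (i.+1 < size u)%N -> u`_i.+1 <= v`_i).

(* [size f] is [deg f + 1] for [f != 0]. *)
Definition zeros_interlace g f : Prop :=
  [/\ g != 0, f != 0, size f = size g \/ size f = (size g).+1 &
      exists u v,
        [/\ zeros_of f u /\ sorted >=%R u,
            zeros_of g v /\ sorted >=%R v &
            alternates v u]].

Definition affine_convention g f : Prop :=
  exists a b c : R,
    [/\ 0 <= a, 0 <= b, 0 <= c, g = a%:P & f = b *: 'X + c%:P].

(* [interlaces g f] is "g interlaces f". *)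
Definition interlaces g f : Prop :=
  [/\ PF g, PF f &
      [\/ zeros_interlace g f, affine_convention g f, g = 0 | f = 0]].

(* For a sequence [(p_n)] indexed by [n >= n0]. *)
Definition generalized_Sturm (n0 : nat) (p : nat -> {poly R}) : Prop :=
  (forall n, (n0 <= n)%N -> PF (p n)) /\
  (forall n, (n0 <= n)%N -> interlaces (p n) (p n.+1)).

(* On the summation range [1 <= i <= d <= n - 1] none of the subtractions on
   [nat] is truncated. *)
Definition h (n : nat) (t : R) : {poly R} :=
  \sum_(1 <= d < n) \sum_(1 <= i < d.+1)
    (('C(n - i - 1, d - i) * 'C(n - d - 1, i - 1))%:R * t ^+ i) *: 'X^d.

End Definitions.

(* Main.v *)
(** The double sum has generating function
      [sum_m g_m z^m = 1 / (1 - (1 + x) z - t x z^2)], where [h_(m+2) = t x g_m],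
    so that [g_(m+2) = (1 + x) g_(m+1) + t x g_m]. At a zero [r < 0] of
    [g_(m+1)] the values of [g_(m+2)] and [g_m] therefore have opposite signs,
    and the classical Sturm argument (the intermediate value theorem between
    consecutive zeros of [g_(m+1)], completed by [0] and a point near minus
    infinity) gives simple negative zeros that strictly interlace. The common
    factor [t x] of the [h_n] adds the zero [0] to every list. *)
Require Import Defs.
From mathcomp Require Import all_boot all_order all_algebra.
From mathcomp Require Import reals.
From mathcomp Require Import polyrcf ring lra zify.
Import Order.TTheory GRing.Theory Num.Theory.
Local Open Scope ring_scope.

(** * Sign changes and zeros of monic real polynomials *)

Section SignChanges.
Variable R : realType.
Implicit Types (f : {poly R}) (p u w : seq R).

(** Exactly [i] of the factors [x - z] are negative. *)
Lemma sign_horner_prod_XsubC u (x : R) i :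
  (i <= size u)%N -> (forall j, (j < i)%N -> x < u`_j) ->
  (forall j, (i <= j < size u)%N -> u`_j < x) ->
  0 < (-1) ^+ i * (\prod_(z <- u) ('X - z%:P)).[x].
Proof.
elim: u i => [|z u IHu] [|i] //= ile lt_xu lt_ux.
- by rewrite big_nil hornerC mulr1.
- rewrite big_cons hornerM mulrCA mulr_gt0 ?IHu //.
    by rewrite hornerXsubC subr_gt0 (lt_ux 0%N).
  by move=> j /= jlt; apply: (lt_ux j.+1).
- rewrite big_cons hornerM exprS mulrACA mulr_gt0 ?IHu //.
  + by rewrite hornerXsubC mulN1r opprB subr_gt0 (lt_xu 0%N).
  + by move=> j jlt; apply: (lt_xu j.+1).
  + by move=> j jlt; apply: (lt_ux j.+1).
Qed.

(** The list [p] has [deg f + 1] points, so the intermediate value theorem puts a zero in each of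
    its [deg f] gaps. These zeros are distinct, hence they are all the zeros of [f]. *)
Lemma alternating_signs_roots f p :
  f \is monic -> size f = size p -> sorted >%R p ->
  (forall i, (i < size p)%N -> 0 < (-1) ^+ i * f.[p`_i]) ->
  exists w, [/\ f = \prod_(z <- w) ('X - z%:P), size p = (size w).+1,
    sorted >%R w & forall i, (i < size w)%N -> p`_i.+1 < w`_i < p`_i].
Proof.
move=> f_monic size_f sorted_p sign_f.
have size_p : size p = (size p).-1.+1.
  by rewrite prednK // -size_f lt0n size_poly_eq0 monic_neq0.
have p_lt i : (i < (size p).-1)%N -> p`_i.+1 < p`_i.
  by move=> i_lt; apply: (sortedP 0 sorted_p); rewrite size_p.
have [w wP] : exists w : 'I_(size p).-1 -> R,
    forall i : 'I_(size p).-1, p`_i.+1 < w i < p`_i /\ root f (w i).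
  apply: (@fin_all_exists _ _ (fun (i : 'I_(size p).-1) x => p`_i.+1 < x < p`_i /\ root f x)) => i.
  have [| x] := @poly_ivtoo _ f p`_i.+1 p`_i (ltW (p_lt i (ltn_ord i))).
    have i_lt : (i.+1 < size p)%N by rewrite -ltn_predRL.
    have := mulr_gt0 (sign_f _ i_lt) (sign_f i (ltnW i_lt)).
    by rewrite mulrACA -exprD addSn addnn exprS -mul2n exprM sqrrN !expr1n
      mulr1 mulN1r oppr_gt0.
  by rewrite in_itv /= => x_in x_root; exists x.
pose s := [seq w i | i <- enum 'I_(size p).-1].
have size_s : size s = (size p).-1 by rewrite size_map size_enum_ord.
have sE i : (i < size s)%N -> p`_i.+1 < s`_i < p`_i.
  rewrite size_s => i_lt; rewrite /s (nth_map (Ordinal i_lt)) ?size_enum_ord //.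
  by have [] := wP (nth (Ordinal i_lt) (enum 'I_(size p).-1) i);
     rewrite nth_enum_ord.
have sorted_s : sorted >%R s.
  apply/(sortedP 0) => i i_lt.
  have /andP[_ lt1] := sE _ i_lt; have /andP[lt2 _] := sE _ (ltnW i_lt).
  exact: lt_trans lt1 lt2.
exists s; split=> //; last by rewrite size_s.
have := @all_roots_prod_XsubC _ f s; rewrite (monicP f_monic) scale1r; apply.
- by rewrite size_s size_f.
- by apply/allP => _ /mapP[i _ ->]; have [] := wP i.
- by rewrite uniq_rootsE (sorted_uniq _ _ sorted_s) //; [exact: rev_trans lt_trans | exact: ltxx].
Qed.

Lemma monic_sign_minfty f (a : R) :
  f \is monic -> exists2 b, b < a & 0 < (-1) ^+ (size f).-1 * f.[b].
(* The reflected polynomial [(-1)^(deg f) f(-x)] is monic, so it is positive beyond its Cauchy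
   bound; the witness is chosen past that bound and below [a]. *)
Proof.
move=> f_monic.
have /monic_Cauchy_bound[b fb_gt0] : (-1) ^+ (size f).-1 *: (f \Po - 'X) \is monic.
  rewrite monicE lead_coefZ lead_coef_comp ?size_polyN ?size_polyX //.
  by rewrite lead_coefN lead_coefX (monicP f_monic) (mulrC 1) signrMK.
exists (- (`|b| + `|a| + 1)).
  by have := ler_norm (- a); rewrite normrN; have := normr_ge0 b; lra.
have := fb_gt0 (`|b| + `|a| + 1); rewrite hornerZ horner_comp !hornerE; apply.
by have := ler_norm b; have := normr_ge0 a; lra.
Qed.

(** One step of the Sturm induction, used with [a = 0]. The signs of [f1] at the new zeros are
    returned because the three-term recurrence turns them into the sign hypothesis of the next
    step. *)
Lemma sturm_step f1 f2 u (a : R) :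
  f1 = \prod_(z <- u) ('X - z%:P) ->
  f2 \is monic -> size f2 = (size u).+2 ->
  sorted >%R u -> (forall i, (i < size u)%N -> u`_i < a) ->
  0 < f2.[a] ->
  (forall i, (i < size u)%N -> 0 < (-1) ^+ i.+1 * f2.[u`_i]) ->
  exists w, [/\ f2 = \prod_(z <- w) ('X - z%:P), size w = (size u).+1,
    sorted >%R w, (forall i, (i < size w)%N -> w`_i < a) &
    alternates u w /\
    forall i, (i < size w)%N -> 0 < (-1) ^+ i * f1.[w`_i]].
Proof.
move=> f1E f2_monic size_f2 sorted_u lt_ua f2a_gt0 sign_f2.
have [b lt_bu sign_b] := @monic_sign_minfty f2 (last a u) f2_monic.
(* These are [deg f2 + 1] decreasing points at which [f2] alternates in sign, starting with a
   positive value at [a]. *)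
pose p := a :: rcons u b.
have size_p : size p = (size u).+2 by rewrite /= size_rcons.
have pS i : (i < size u)%N -> p`_i.+1 = u`_i by move=> ilt; rewrite /= nth_rcons ilt.
have trans_gt : transitive (>%R : rel R) := rev_trans lt_trans.
have sorted_p : sorted >%R p.
  rewrite /= rcons_path; apply/andP; split; last exact: lt_bu.
  rewrite path_sortedE // sorted_u andbT.
  by apply/(all_nthP 0) => i /lt_ua.
have [|i|w [f2E size_w sorted_w wP]] := @alternating_signs_roots f2 p f2_monic _ sorted_p.
- by rewrite size_p.
- rewrite size_p; case: i => [|i] ilt; first by rewrite mul1r.
  rewrite /= nth_rcons; have [/sign_f2 //|le_ui] := ltnP i (size u).
  have -> : i = size u by lia.
  by rewrite eqxx; move: sign_b; rewrite size_f2.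
have {}size_w : size w = (size u).+1 by case: size_w; rewrite size_rcons.
have p_anti i j : (i < j < (size u).+2)%N -> p`_j < p`_i.
  move=> /andP[lt_ij lt_j].
  by apply: (sorted_ltn_nth trans_gt) => //; rewrite inE size_p //; lia.
exists w; split => // [i ilt|].
  have /andP[_ lt_wp] := wP _ ilt.
  by case: i ilt lt_wp => // i ilt /lt_trans; apply; apply: (p_anti 0%N); lia.
split; first split => i ilt.
- have /andP[lt_pw _] : p`_i.+1 < w`_i < p`_i by apply: wP; lia.
  by rewrite -pS // ltW.
- have /andP[_] := wP _ ilt; rewrite pS; last by lia.
  exact: ltW.
move=> i ilt; have /andP[lt_pw lt_wp] := wP _ ilt.
(* Counting from 0, [w_i] lies strictly between [p_(i+1) = u_i] and [p_i], so exactly [i] zeros of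
   [f1] exceed it. *)
rewrite f1E; apply: sign_horner_prod_XsubC => [|j jlt|j jlt]; first by lia.
- rewrite -pS; last by lia.
  have [->|neq_ij] := eqVneq j.+1 i; first by [].
  by apply: lt_trans lt_wp _; apply: p_anti; lia.
- rewrite -pS; last by lia.
  have [->|neq_ij] := eqVneq j i; first by [].
  by apply: lt_trans lt_pw; apply: p_anti; lia.
Qed.

End SignChanges.

(** * The three-term recurrence, by Pascal's rule on coefficients *)

Section Recurrence.
Variables (R : realType) (t : R).

(** The inner sum of [h m.+2 t] at degree [d.+1], with [b = i - 1] and one factor [t] removed. *)
Definition gcoef (m d : nat) : R :=
  \sum_(0 <= b < d.+1) ('C(m - b, d - b) * 'C(m - d, b))%:R * t ^+ b.

Definition g (m : nat) : {poly R} := \poly_(d < m.+1) gcoef m d.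

Lemma h_eq_g m : h m.+2 t = t *: ('X * g m).
Proof.
rewrite /h /g big_add1 poly_def mulr_sumr scaler_sumr /= big_mkord.
apply: eq_bigr => d _; rewrite -scalerAr -exprS scalerA -scaler_suml.
congr (_ *: _); rewrite big_add1 mulr_sumr; apply: eq_bigr => b _.
have -> : (m.+2 - b.+1 - 1 = m - b)%N by lia.
have -> : (m.+2 - d.+1 - 1 = m - d)%N by lia.
by rewrite subSS subn1 exprS mulrCA.
Qed.

Lemma coef_g m d : (g m)`_d = gcoef m d.
Proof.
(* Beyond degree [m] the truncated [m - d = 0] kills the terms with [b > 0], and ['C(m, d) = 0]
   kills the term [b = 0]. *)
rewrite coef_poly ltnS; case: leqP => // lt_md.
rewrite /gcoef big1_seq // => b _; have -> : (m - d = 0)%N by lia.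
by case: b => [|b]; rewrite ?bin0n ?muln0 ?mul0r // !subn0 bin_small // mul0n mul0r.
Qed.

Lemma g0 : g 0 = 1.
Proof.
rewrite /g poly_def big_ord1 /gcoef big_nat1.
by rewrite !mul1r expr0 scale1r.
Qed.

Lemma g1 : g 1 = 1 + 'X.
Proof.
rewrite /g poly_def big_ord_recl big_ord1 /gcoef big_nat1.
rewrite big_nat_recl // big_nat1 /= !mul1r !expr0 !scale1r.
by rewrite (_ : 'C(_, _) * _ = 0)%N // mul0r addr0 scale1r.
Qed.

(** Pascal's rule is applied to each binomial factor in turn. The factor [0 < b] cancels the
    spurious term that [b.-1 = 0] would give at [b = 0]. *)
Lemma gcoef_term_rec m d b : (b <= d)%N ->
  ('C(m.+2 - b, d.+1 - b) * 'C(m.+2 - d.+1, b) =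
   'C(m.+1 - b, d.+1 - b) * 'C(m.+1 - d.+1, b) +
   'C(m.+1 - b, d - b) * 'C(m.+1 - d, b) +
   (0 < b) * ('C(m - b.-1, d - b.-1) * 'C(m - d, b.-1)))%N.
Proof.
move=> le_bd; rewrite !subSS.
have [lt_md|le_dm] := ltnP m d.
  have -> : (m - d = 0)%N by lia.
  case: b le_bd => [|b] le_bd /=.
    by rewrite !subn0 !bin0 mul0n addn0 !muln1 binS.
  rewrite !bin0n mul1n /=.
  have -> : (m.+1 - d = 0)%N by lia.
  rewrite !muln0 !add0n; case: b le_bd => [|b] le_bd; last by rewrite muln0.
  by rewrite !subn0 bin_small.
have -> : (m.+2 - b = (m.+1 - b).+1)%N by lia.
have -> : (d.+1 - b = (d - b).+1)%N by lia.
have -> : (m.+1 - d = (m - d).+1)%N by lia.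
rewrite binS; case: b le_bd => [|b] le_bd /=.
  by rewrite !bin0 !muln1 mul0n addn0.
rewrite [in LHS]binS binS.
have -> : (d - b = (d - b.+1).+1)%N by lia.
have -> : (m - b = m.+1 - b.+1)%N by lia.
ring.
Qed.

Lemma gcoef_rec m d :
  gcoef m.+2 d.+1 = gcoef m.+1 d.+1 + gcoef m.+1 d + t * gcoef m d.
Proof.
(* The top terms [b = d.+1] lie outside [gcoef_term_rec]; they are split off and matched by a
   separate Pascal identity. *)
rewrite /gcoef big_nat_recr //= [in RHS]big_nat_recr //=.
under eq_big_nat => b /andP[_ le_bd].
  rewrite gcoef_term_rec // !natrD !mulrDl; over.
rewrite !big_split /= [X in _ + _ + X + _]big_nat_recl //= [X in _ + t * X]big_nat_recr //=.
rewrite mul0n mul0r add0r mulrDr mulr_sumr !subnn !bin0 !mul1n !subSS.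
have -> : ('C(m.+1 - d, d.+1) = 'C(m - d, d.+1) + 'C(m - d, d))%N.
  have [le_dm|lt_md] := leqP d m; first by rewrite subSn // binS.
  have [-> ->] : (m.+1 - d = 0 /\ m - d = 0)%N by lia.
  by rewrite !bin0n; case: d lt_md.
rewrite natrD mulrDl (mulrCA t) -exprS.
rewrite [X in _ + _ + X + _](eq_bigr (fun b => t * (('C(m - b, d - b) * 'C(m - d, b))%:R * t ^+ b))).
  ring.
by move=> b _; rewrite mul1n mulrCA -exprS.
Qed.

Lemma g_rec m : g m.+2 = (1 + 'X) * g m.+1 + t *: ('X * g m).
Proof.
apply/polyP => -[|d].
  rewrite mulrDl mul1r !coefD coefZ !coefXM /= !coef_g mulr0 !addr0.
  by rewrite /gcoef !big_nat1 !subn0 !bin0.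
by rewrite mulrDl mul1r !coefD coefZ !coefXM /= !coef_g gcoef_rec.
Qed.
End Recurrence.

(** * The Sturm induction on [g], and its transfer to [h] *)

Section Sturm.
Variables (R : realType) (t : R).
Hypothesis t_gt0 : 0 < t.
Let g := g R t.

Lemma gcoef_ge0 m d : 0 <= gcoef R t m d.
Proof. by apply: sumr_ge0 => b _; rewrite mulr_ge0 ?ler0n ?exprn_ge0 // ltW. Qed.

Lemma gcoef_lead m : gcoef R t m m = 1.
Proof.
rewrite /gcoef big_nat_recl // subn0 subnn binn bin0 mul1r expr0 big1 ?addr0 //.
by move=> b _; rewrite bin0n muln0 mul0r.
Qed.

Lemma size_g m : size (g m) = m.+1.
Proof. by apply: size_poly_eq; rewrite gcoef_lead oner_neq0. Qed.

Lemma g_monic m : g m \is monic.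
Proof. by rewrite monicE lead_coefE size_g coef_g gcoef_lead. Qed.

Lemma g_horner0 m : (g m).[0] = 1.
Proof. by rewrite horner_coef0 coef_g /gcoef big_nat1 !subn0 !bin0 mul1r. Qed.

Lemma g_sturm m : exists v u : seq R,
  [/\ [/\ g m = \prod_(z <- v) ('X - z%:P), size v = m, sorted >%R v &
          forall i, (i < size v)%N -> v`_i < 0],
      [/\ g m.+1 = \prod_(z <- u) ('X - z%:P), size u = m.+1, sorted >%R u &
          forall i, (i < size u)%N -> u`_i < 0],
      alternates v u &
      forall i, (i < size u)%N -> 0 < (-1) ^+ i * (g m).[u`_i]].
Proof.
elim: m => [|m [_ [u [_ [g1E size_u sorted_u u_lt0] _ sign_u]]]].
  exists [::], [:: -1]; split.
  - by rewrite /g g0 big_nil.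
  - split=> // [|[|i]] //=; first by rewrite /g g1 big_seq1 polyCN opprK addrC.
    by rewrite oppr_lt0 ltr01.
  - by split=> [|[|i]].
  - by case=> [|i] // _; rewrite /g g0 hornerC mulr1.
have [||i ilt|w [g2E size_w sorted_w w_lt0 [alt_w sign_w]]] :=
    @sturm_step R (g m.+1) (g m.+2) u 0 g1E (g_monic _) _ sorted_u u_lt0.
- by rewrite size_g size_u.
- by rewrite g_horner0 ltr01.
- have u_root : (g m.+1).[u`_i] = 0.
    by apply/eqP; rewrite g1E -rootE root_prod_XsubC mem_nth.
  (* At a zero of [g m.+1] the recurrence leaves [t * u_i * g_m(u_i)]; the negative [u_i] supplies
     the extra sign. *)
  rewrite /g g_rec !hornerE [(_ m.+1).[_]]u_root mulr0 add0r exprS.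
  rewrite (_ : _ * _ = t * - u`_i * ((-1) ^+ i * (g m).[u`_i])); last by rewrite /g /=; ring.
  apply: mulr_gt0; last exact: sign_u.
  by rewrite mulr_gt0 // oppr_gt0 u_lt0.
by exists u, w; split=> //; split=> //; rewrite size_w size_u.
Qed.

Lemma zeros_of_h m v : g m = \prod_(z <- v) ('X - z%:P) ->
  zeros_of (h m.+2 t) (0 :: v).
Proof.
move=> gE; rewrite /zeros_of h_eq_g -/(g m) big_cons subr0 -gE.
by rewrite lead_coefZ lead_coefM lead_coefX (monicP (g_monic m)) !mulr1.
Qed.

Lemma size_h m : size (h m.+2 t) = m.+2.
Proof.
by rewrite h_eq_g size_scale ?gt_eqF // mulrC size_mulX ?monic_neq0 ?g_monic ?size_g.
Qed.

Lemma h_neq0 m : h m.+2 t != 0.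
Proof. by rewrite -size_poly_eq0 size_h. Qed.

Lemma PF_h m : PF (h m.+2 t).
Proof.
split=> [|[|k]]; last 2 first.
- by rewrite h_eq_g coefZ coefXM mulr0.
- by rewrite h_eq_g coefZ coefXM coef_g mulr_ge0 ?gcoef_ge0 // ltW.
have [v [_ [[gE _ _ _] _ _ _]]] := g_sturm m.
by exists (0 :: v); apply: zeros_of_h.
Qed.

Lemma sorted_ge0_cons (v : seq R) : sorted >%R v ->
  (forall i, (i < size v)%N -> v`_i < 0) -> sorted >=%R (0 :: v).
Proof.
move=> sorted_v v_lt0; apply/(sortedP 0) => -[|i] /= ilt; first exact/ltW/v_lt0.
exact/ltW/(sortedP 0 sorted_v).
Qed.

Lemma interlaces_h m : interlaces (h m.+2 t) (h m.+3 t).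
Proof.
split; [exact: PF_h | exact: PF_h | constructor 1].
have [v [u [[gvE size_v sorted_v v_lt0] [guE size_u sorted_u u_lt0] [alt1 alt2] _]]] :=
  g_sturm m.
split; [exact: h_neq0 | exact: h_neq0 | by right; rewrite !size_h |].
(* The common zero 0 is the largest in both lists. Prepending it shifts the old inequalities by one
   place; the only new nontrivial one is [u_0 <= 0]. *)
exists (0 :: u), (0 :: v); split.
- by split; [exact: zeros_of_h | exact: sorted_ge0_cons].
- by split; [exact: zeros_of_h | exact: sorted_ge0_cons].
split=> -[|i] //= ilt; first exact: alt1.
- exact/ltW/u_lt0.
- exact: alt2.
Qed.

End Sturm.

Theorem theorem3p3 (R : realType) (t : R) (ht : 0 < t) :
  generalized_Sturm 2 (fun n => h n t).
Proof. by split=> -[|[|m]] // _; [exact: PF_h | exact: interlaces_h]. Qed.
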